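(* Let $f$ be a real function on $[0,\infty)$, differentiable at $0$, with $f'(0)>0$. Consider the eigenvalue problem $$-\phi''+\phi=0\ \text{ in }(0,1),\qquad -\phi'(0)-\lambda f'(0)\phi(0)=0,\qquad \phi'(1)-\lambda f'(0)\phi(1)=0 .$$ Its principal eigenvalue (the smallest positive $\lambda$ for which a nontrivial solution $\phi$ exists) is $$\lambda_1=\frac{\cosh(1)-1}{f'(0)\sinh(1)},$$ and the corresponding eigenfunction $$\phi_1(x)=\cosh(x)-\left(\frac{\cosh(1)-1}{\sinh(1)}\right)\sinh(x)$$ satisfies $\phi_1(x)>0$ for all $x\in(0,1)$.
   Context: The problem is the linearization at the trivial solution of the one-dimensional boundary value problem $-u''+u=0$ in $(0,1)$ with outward normal derivative equal to $\lambda f(u)$ at $x=0$ and $x=1$, where $f(0)=0$. Only the number $f'(0)>0$ enters. *)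

(* Defs.v *)
From Stdlib Require Import Reals.
Open Scope R_scope.

(* The derivative of g at x relative to the set D is l.  Only the values of g
   on D (and at x) matter, so a function on D is represented by any of its
   extensions to R; at an endpoint of an interval this is the one-sided
   derivative. *)
Definition has_derivative_within (D : R -> Prop) (g : R -> R) (x l : R) : Prop :=
  D_in g (fun _ => l) D x.

(* Classical solutions phi : [0,1] -> R of
     - phi'' + phi = 0 in (0,1),
     - phi'(0) - lambda * a * phi(0) = 0,   phi'(1) - lambda * a * phi(1) = 0.
   Continuity of phi' and phi'' need not be demanded: phi'' = phi is continuous
   on (0,1), and phi' is then continuous up to the endpoints. *)
Definition is_solution (a lambda : R) (phi : R -> R) : Prop :=
  exists dphi d2phi : R -> R,
    (forall x, 0 <= x <= 1 ->
       has_derivative_within (fun y => 0 <= y <= 1) phi x (dphi x)) /\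
    (forall x, 0 < x < 1 -> derivable_pt_lim dphi x (d2phi x)) /\
    (forall x, 0 < x < 1 -> - d2phi x + phi x = 0) /\
    - dphi 0 - lambda * a * phi 0 = 0 /\
    dphi 1 - lambda * a * phi 1 = 0.

Definition is_eigenfunction (a lambda : R) (phi : R -> R) : Prop :=
  is_solution a lambda phi /\ exists x, 0 <= x <= 1 /\ phi x <> 0.

Definition is_eigenvalue (a lambda : R) : Prop :=
  exists phi : R -> R, is_eigenfunction a lambda phi.

Definition is_principal_eigenvalue (a lambda : R) : Prop :=
  0 < lambda /\ is_eigenvalue a lambda /\
  forall mu, 0 < mu -> is_eigenvalue a mu -> lambda <= mu.

Definition lambda1 (a : R) : R := (cosh 1 - 1) / (a * sinh 1).

Definition phi1 (x : R) : R := cosh x - (cosh 1 - 1) / sinh 1 * sinh x.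

(* Main.v *)
Require Import Defs.
From Stdlib Require Import Reals Lra.
Open Scope R_scope.

(** The equation [phi'' = phi] factors: [phi + phi'] solves [u' = u] and
    [phi - phi'] solves [u' = - u], so [phi] is a combination
    [A cosh + B sinh] on (0,1) ([solution_inside]).  Continuity extends this
    formula to the closed interval, and uniqueness of one-sided derivatives
    then identifies [phi'] at both endpoints ([solution_form]).

    With [m = lambda * a], [c = cosh 1] and [s = sinh 1], the condition at 0
    says [B = - m A], and the one at 1 becomes [m^2 s - 2 m c + s = 0] for
    [A <> 0].  Since [c^2 - s^2 = 1], multiplying by [s] factors this as
    [(m s - (c - 1)) (m s - (c + 1)) = 0] ([characteristic_equation]), whose
    smaller root is [m = (c - 1) / s]; the eigenspace there is spanned by
    [cosh - m sinh = phi1].  Positivity is read off from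
    [s phi1 x = sinh (1 - x) + sinh x]. *)

(** * One-sided derivatives *)

Lemma has_derivative_within_of_derivable (D : R -> Prop) (g : R -> R) (x l : R) :
  derivable_pt_lim g x l -> has_derivative_within D g x l.
Proof.
  intros Hg eps Heps.
  destruct (Hg eps Heps) as [del Hdel].
  exists del; split; [exact (cond_pos del)|].
  intros y [[_ Hne] Hy]; simpl in *; unfold Rdist in *.
  specialize (Hdel (y - x)).
  replace (x + (y - x)) with y in Hdel by ring.
  apply Hdel; [lra | exact Hy].
Qed.

Lemma has_derivative_within_interior (a b : R) (g : R -> R) (x l : R) :
  a < x < b -> has_derivative_within (fun y => a <= y <= b) g x l ->
  derivable_pt_lim g x l.
Proof.
  intros Hx Hg eps Heps.
  destruct (Hg eps Heps) as [del [Hdel Hlim]].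
  assert (Hmin : 0 < Rmin del (Rmin (x - a) (b - x))).
  { repeat apply Rmin_pos; lra. }
  exists (mkposreal _ Hmin); intros h Hh0 Hh; simpl in Hh.
  pose proof (Rmin_l del (Rmin (x - a) (b - x))).
  pose proof (Rmin_r del (Rmin (x - a) (b - x))).
  pose proof (Rmin_l (x - a) (b - x)).
  pose proof (Rmin_r (x - a) (b - x)).
  specialize (Hlim (x + h)); simpl in Hlim; unfold Rdist in Hlim.
  replace (x + h - x) with h in Hlim by ring.
  apply Hlim; split; [split|]; try lra.
  apply Rabs_def2 in Hh; lra.
Qed.

Lemma adherent_interior (a b x : R) :
  a < b -> a <= x <= b -> adhDa (fun y => a < y < b /\ y <> x) x.
Proof.
  intros Hab Hx del Hdel.
  (* a short step from x towards the farther endpoint stays inside *)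
  set (t := Rmin del (b - a) / 3).
  assert (Ht : 0 < Rmin del (b - a)) by (apply Rmin_pos; lra).
  pose proof (Rmin_l del (b - a)); pose proof (Rmin_r del (b - a)).
  destruct (Rle_lt_dec x ((a + b) / 2)).
  - exists (x + t); unfold Rdist, t; split; [lra|].
    apply Rabs_def1; lra.
  - exists (x - t); unfold Rdist, t; split; [lra|].
    apply Rabs_def1; lra.
Qed.

(** Both the values and the derivatives are limits from inside the interval,
    hence agreement in the interior propagates to the endpoints. *)
Lemma eq_on_closed_of_eq_on_open (a b : R) (g h dg dh : R -> R) :
  a < b ->
  (forall x, a <= x <= b -> has_derivative_within (fun y => a <= y <= b) g x (dg x)) ->
  (forall x, a <= x <= b -> has_derivative_within (fun y => a <= y <= b) h x (dh x)) ->
  (forall x, a < x < b -> g x = h x) ->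
  forall x, a <= x <= b -> g x = h x /\ dg x = dh x.
Proof.
  intros Hab Hg Hh Heq.
  assert (Hsub : forall x y, a < y < b /\ y <> x -> D_x (fun y => a <= y <= b) x y).
  { intros x y Hy; split; [lra | intros E; apply (proj2 Hy); auto]. }
  assert (Hval : forall x, a <= x <= b -> g x = h x).
  { intros x Hx.
    apply (single_limit h (fun y => a < y < b /\ y <> x) _ _ x).
    - apply adherent_interior; auto.
    - apply (limit1_ext g); [intros y Hy; apply Heq; tauto|].
      apply (limit1_imp _ _ _ _ _ (Hsub x)).
      exact (cont_deriv _ _ _ _ (Hg x Hx)).
    - apply (limit1_imp _ _ _ _ _ (Hsub x)).
      exact (cont_deriv _ _ _ _ (Hh x Hx)). }
  intros x Hx; split; [auto|].
  apply (single_limit (fun y => (h y - h x) / (y - x))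
           (fun y => a < y < b /\ y <> x) _ _ x).
  - apply adherent_interior; auto.
  - apply (limit1_ext (fun y => (g y - g x) / (y - x))).
    + intros y Hy; rewrite (Heq y (proj1 Hy)), (Hval x Hx); reflexivity.
    + exact (limit1_imp _ _ _ _ _ (Hsub x) (Hg x Hx)).
  - exact (limit1_imp _ _ _ _ _ (Hsub x) (Hh x Hx)).
Qed.

(** * Solutions of the differential equation *)

Lemma null_derivative_constant (a b : R) (g : R -> R) :
  (forall x, a < x < b -> derivable_pt_lim g x 0) ->
  forall x y, a < x < b -> a < y < b -> g x = g y.
Proof.
  intros Hg.
  assert (Hlt : forall x y, a < x < b -> a < y < b -> x < y -> g x = g y).
  { intros x y Hx Hy Hxy.
    destruct (MVT_cor2 g (fun _ => 0) x y Hxy) as [z [Hz _]].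
    - intros z Hz; apply Hg; lra.
    - lra. }
  intros x y Hx Hy.
  destruct (Rtotal_order x y) as [H | [H | H]].
  - auto.
  - now rewrite H.
  - symmetry; auto.
Qed.

(** [u' = r u] makes [u exp (- r x)] constant. *)
Lemma first_order_solution (a b r : R) (u : R -> R) :
  a < b ->
  (forall x, a < x < b -> derivable_pt_lim u x (r * u x)) ->
  exists k, forall x, a < x < b -> u x = k * exp (r * x).
Proof.
  intros Hab Hu.
  set (w := fun x => u x * exp (- r * x)).
  assert (Hw : forall x, a < x < b -> derivable_pt_lim w x 0).
  { intros x Hx.
    assert (He : derivable_pt_lim (fun y => exp (- r * y)) x (exp (- r * x) * (- r * 1))).
    { apply (derivable_pt_lim_comp (fun y => - r * y) exp).
      - apply (derivable_pt_lim_scal id (- r) x 1), derivable_pt_lim_id.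
      - apply derivable_pt_lim_exp. }
    pose proof (derivable_pt_lim_mult _ _ _ _ _ (Hu x Hx) He) as H.
    replace 0 with (r * u x * exp (- r * x) + u x * (exp (- r * x) * (- r * 1))) by ring.
    exact H. }
  exists (w ((a + b) / 2)); intros x Hx.
  rewrite (null_derivative_constant a b w Hw ((a + b) / 2) x) by lra.
  unfold w; rewrite Rmult_assoc, <- exp_plus.
  replace (- r * x + r * x) with 0 by ring.
  rewrite exp_0; ring.
Qed.

Lemma solution_inside (a b : R) (phi dphi : R -> R) :
  a < b ->
  (forall x, a < x < b -> derivable_pt_lim phi x (dphi x)) ->
  (forall x, a < x < b -> derivable_pt_lim dphi x (phi x)) ->
  exists A B, forall x, a < x < b -> phi x = A * cosh x + B * sinh x.
Proof.
  intros Hab H1 H2.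
  destruct (first_order_solution a b 1 (fun x => phi x + dphi x) Hab) as [p Hp].
  { intros x Hx.
    replace (1 * (phi x + dphi x)) with (dphi x + phi x) by ring.
    apply (derivable_pt_lim_plus phi dphi); auto. }
  destruct (first_order_solution a b (-1) (fun x => phi x - dphi x) Hab) as [q Hq].
  { intros x Hx.
    replace (-1 * (phi x - dphi x)) with (dphi x - phi x) by ring.
    apply (derivable_pt_lim_minus phi dphi); auto. }
  exists ((p + q) / 2), ((p - q) / 2); intros x Hx.
  specialize (Hp x Hx); specialize (Hq x Hx); simpl in Hp, Hq.
  replace (1 * x) with x in Hp by ring.
  replace (-1 * x) with (- x) in Hq by ring.
  unfold cosh, sinh; lra.
Qed.

Lemma derivable_cosh_sinh (A B x : R) :
  derivable_pt_lim (fun y => A * cosh y + B * sinh y) x (A * sinh x + B * cosh x).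
Proof.
  apply (derivable_pt_lim_plus (fun y => A * cosh y) (fun y => B * sinh y)).
  - apply (derivable_pt_lim_scal cosh), derivable_pt_lim_cosh.
  - apply (derivable_pt_lim_scal sinh), derivable_pt_lim_sinh.
Qed.

(** The boundary condition at 0 is [B = - lambda a A] since [cosh 0 = 1] and
    [sinh 0 = 0]; it is already substituted in the formula for [phi]. *)
Lemma solution_form (a lambda : R) (phi : R -> R) :
  is_solution a lambda phi ->
  exists A,
    (forall x, 0 <= x <= 1 -> phi x = A * (cosh x - lambda * a * sinh x)) /\
    A * (sinh 1 - lambda * a * cosh 1) =
      lambda * a * (A * (cosh 1 - lambda * a * sinh 1)).
Proof.
  intros [dphi [d2phi [Hd [Hd2 [Heq [H0 H1]]]]]].
  destruct (solution_inside 0 1 phi dphi) as [A [B HAB]]; [lra | | |].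
  - intros x Hx; apply (has_derivative_within_interior 0 1); [exact Hx|].
    apply Hd; lra.
  - intros x Hx; replace (phi x) with (d2phi x) by (specialize (Heq x Hx); lra).
    auto.
  - pose proof (eq_on_closed_of_eq_on_open 0 1 phi (fun x => A * cosh x + B * sinh x)
      dphi (fun x => A * sinh x + B * cosh x) Rlt_0_1 Hd
      (fun x _ => has_derivative_within_of_derivable _ _ _ _ (derivable_cosh_sinh A B x))
      HAB) as Hform; simpl in Hform.
    destruct (Hform 0) as [Ev0 Ed0]; [lra|].
    destruct (Hform 1) as [Ev1 Ed1]; [lra|].
    rewrite cosh_0, sinh_0 in Ev0, Ed0.
    assert (HB : B = - (lambda * a * A)).
    { rewrite Ev0, Ed0 in H0; lra. }
    exists A; split.
    + intros x Hx; rewrite (proj1 (Hform x Hx)), HB; ring.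
    + rewrite Ev1, Ed1, HB in H1; lra.
Qed.

Lemma combination_is_solution (a lambda m : R) :
  lambda * a = m ->
  sinh 1 - m * cosh 1 = m * (cosh 1 - m * sinh 1) ->
  is_solution a lambda (fun x => cosh x - m * sinh x).
Proof.
  intros Hm Hbc.
  assert (Hd : forall x, derivable_pt_lim (fun y => cosh y - m * sinh y) x
                           (sinh x - m * cosh x)).
  { intros x; apply (derivable_pt_lim_minus cosh (fun y => m * sinh y)).
    - apply derivable_pt_lim_cosh.
    - apply (derivable_pt_lim_scal sinh), derivable_pt_lim_sinh. }
  exists (fun x => sinh x - m * cosh x), (fun x => cosh x - m * sinh x).
  repeat split.
  - intros x _; apply has_derivative_within_of_derivable, Hd.
  - intros x _; apply (derivable_pt_lim_minus sinh (fun y => m * cosh y)).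
    + apply derivable_pt_lim_sinh.
    + apply (derivable_pt_lim_scal cosh), derivable_pt_lim_cosh.
  - intros x _; ring.
  - rewrite cosh_0, sinh_0, Hm; ring.
  - rewrite Hm, Hbc; ring.
Qed.

(** * The characteristic equation *)

Lemma sinh_pos (x : R) : 0 < x -> 0 < sinh x.
Proof.
  intros Hx; rewrite <- sinh_0; apply sinh_lt, Hx.
Qed.

Lemma cosh_pos (x : R) : 0 < cosh x.
Proof.
  unfold cosh; pose proof (exp_pos x); pose proof (exp_pos (- x)); lra.
Qed.

Lemma sinh_minus (x y : R) : sinh (x - y) = sinh x * cosh y - cosh x * sinh y.
Proof.
  unfold sinh, cosh.
  replace (- (x - y)) with (- x + y) by ring.
  replace (x - y) with (x + - y) by ring.
  rewrite !exp_plus; field.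
Qed.

Lemma cosh_sqr (x : R) : cosh x * cosh x = 1 + sinh x * sinh x.
Proof.
  replace 1 with (exp x * exp (- x)).
  - unfold cosh, sinh; field.
  - rewrite <- exp_plus, Rplus_opp_r; apply exp_0.
Qed.

Lemma cosh_1_gt_1 : 1 < cosh 1.
Proof.
  pose proof (cosh_sqr 1); pose proof (sinh_pos 1 Rlt_0_1).
  pose proof (cosh_pos 1); nra.
Qed.

Lemma characteristic_equation (m : R) :
  sinh 1 - m * cosh 1 = m * (cosh 1 - m * sinh 1) <->
  (m * sinh 1 - (cosh 1 - 1)) * (m * sinh 1 - (cosh 1 + 1)) = 0.
Proof.
  pose proof (cosh_sqr 1) as Hc.
  pose proof (sinh_pos 1 Rlt_0_1) as Hs.
  assert (E : (m * sinh 1 - (cosh 1 - 1)) * (m * sinh 1 - (cosh 1 + 1)) =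
              sinh 1 * (sinh 1 - m * cosh 1 - m * (cosh 1 - m * sinh 1))).
  { replace ((m * sinh 1 - (cosh 1 - 1)) * (m * sinh 1 - (cosh 1 + 1))) with
      (m * m * (sinh 1 * sinh 1) - 2 * m * sinh 1 * cosh 1 + (cosh 1 * cosh 1 - 1)) by ring.
    rewrite Hc; ring. }
  rewrite E; split; intros H.
  - rewrite H; ring.
  - apply Rmult_integral in H; lra.
Qed.

Lemma lambda1_mult (a : R) :
  0 < a -> lambda1 a * a = (cosh 1 - 1) / sinh 1.
Proof.
  intros Ha; pose proof (sinh_pos 1 Rlt_0_1).
  unfold lambda1; field; lra.
Qed.

Lemma phi1_is_eigenfunction (a : R) :
  0 < a -> is_eigenfunction a (lambda1 a) phi1.
Proof.
  intros Ha; pose proof (sinh_pos 1 Rlt_0_1) as Hs; split.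
  - apply combination_is_solution; [apply lambda1_mult, Ha|].
    apply characteristic_equation; field; lra.
  - exists 0; split; [lra|].
    unfold phi1; rewrite cosh_0, sinh_0; lra.
Qed.

Lemma eigenvalue_lower_bound (a mu : R) :
  0 < a -> is_eigenvalue a mu -> lambda1 a <= mu.
Proof.
  intros Ha [phi [Hsol [x [Hx Hne]]]].
  destruct (solution_form _ _ _ Hsol) as [A [Hphi Hbc]].
  assert (HA : A <> 0).
  { intros E; apply Hne; rewrite (Hphi x Hx), E; ring. }
  pose proof (sinh_pos 1 Rlt_0_1) as Hs.
  assert (Hchar : sinh 1 - mu * a * cosh 1 = mu * a * (cosh 1 - mu * a * sinh 1)).
  { apply (Rmult_eq_reg_l A); [rewrite Hbc; ring | exact HA]. }
  apply characteristic_equation in Hchar.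
  apply (Rmult_le_reg_r a); [exact Ha|]; rewrite lambda1_mult by exact Ha.
  apply (Rmult_le_reg_r (sinh 1)); [exact Hs|].
  replace ((cosh 1 - 1) / sinh 1 * sinh 1) with (cosh 1 - 1) by (field; lra).
  apply Rmult_integral in Hchar; lra.
Qed.

(** The difference in the definition of [phi1] hides its sign.  Written in the
    basis [sinh x], [sinh (1 - x)], which is positive inside the interval,
    [phi1] has both coefficients equal to [1 / sinh 1]. *)
Lemma phi1_pos (x : R) : 0 < x < 1 -> 0 < phi1 x.
Proof.
  intros Hx.
  pose proof (sinh_pos 1 Rlt_0_1) as Hs.
  assert (E : phi1 x = (sinh (1 - x) + sinh x) / sinh 1).
  { rewrite sinh_minus; unfold phi1; field; lra. }
  rewrite E; apply Rdiv_lt_0_compat; [|exact Hs].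
  apply Rplus_lt_0_compat; apply sinh_pos; lra.
Qed.

Theorem mainTheorem6 (f : R -> R) (f'0 : R)
  (Hf : has_derivative_within (fun x => 0 <= x) f 0 f'0)
  (Hpos : 0 < f'0) :
  is_principal_eigenvalue f'0 (lambda1 f'0) /\
  is_eigenfunction f'0 (lambda1 f'0) phi1 /\
  (forall phi : R -> R, is_eigenfunction f'0 (lambda1 f'0) phi ->
     exists k : R, forall x, 0 <= x <= 1 -> phi x = k * phi1 x) /\
  (forall x, 0 < x < 1 -> 0 < phi1 x).
Proof.
  pose proof (phi1_is_eigenfunction f'0 Hpos) as Heig.
  repeat split.
  - pose proof cosh_1_gt_1.
    unfold lambda1; apply Rdiv_lt_0_compat; [lra|].
    apply Rmult_lt_0_compat; [exact Hpos | apply sinh_pos, Rlt_0_1].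
  - exists phi1; exact Heig.
  - intros mu _ Hmu; apply eigenvalue_lower_bound; assumption.
  - apply Heig.
  - apply Heig.
  - intros phi [Hsol _].
    destruct (solution_form _ _ _ Hsol) as [A [Hphi _]].
    rewrite (lambda1_mult _ Hpos) in Hphi.
    exists A; exact Hphi.
  - exact phi1_pos.
Qed.
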